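(* Let $\nu\ge1$ be an integer. Every $(\nu-1)$-Strongly Smooth MDP (with $\mathcal S=[-1,1]^{d_S}$, $\mathcal A=[-1,1]^{d_A}$) is a Mildly Smooth MDP of order $\nu$; that is, if $M$ is $(\nu-1)$-Strongly Smooth then there is a constant $C_{\mathcal T}<\infty$ such that $\|\mathcal T_hf\|_{\mathcal C^\nu}\le C_{\mathcal T}(\|f\|_{L^\infty}+1)$ for every $h\in[H]$ and every $f\in L^\infty(\mathcal Z)$.
   Context: $M=(\mathcal S,\mathcal A,p,r,H)$ is a finite-horizon MDP, $\mathcal Z=\mathcal S\times\mathcal A=[-1,1]^d$, with mean rewards $r_h:\mathcal Z\to\mathbb R$ and transition kernels $p_h(\cdot|z)$ on $\mathcal S$. Bellman optimality operator: $\mathcal T_hf(s,a)=r_h(s,a)+\mathbb E_{s'\sim p_h(\cdot|s,a)}[\sup_{a'\in\mathcal A}f(s',a')]$. For $\nu>0$ let $\nu_*=\lceil\nu-1\rceil$. $f\in\mathcal C^\nu(\mathcal Z)$ if $f$ is $\nu_*$-times continuously differentiable and there is a constant $L_\nu(f)$ (the smallest such) with $|D^{\boldsymbol\alpha}f(x)-D^{\boldsymbol\alpha}f(y)|\le L_\nu(f)\|x-y\|_\infty^{\nu-\nu_*}$ for all $\|\boldsymbol\alpha\|_1=\nu_*$ and $x,y\in\mathcal Z$; $\|f\|_{\mathcal C^\nu}=\max\{\max_{\|\boldsymbol\alpha\|_1\le\nu_*}\|D^{\boldsymbol\alpha}f\|_{L^\infty},L_\nu(f)\}$. For integer $\nu$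 this space coincides with $\mathcal C^{\nu-1,1}(\mathcal Z)$. **$(\nu-1)$-Strongly Smooth MDP:** the transition kernels have densities $p_h(s'|z)$ with respect to Lebesgue measure on $\mathcal S$, and there are constants $C_r,C_p<\infty$ such that for every $h$ one has $\|r_h\|_{\mathcal C^{\nu-1,1}(\mathcal Z)}\le C_r$ and $\|p_h(s'|\cdot)\|_{\mathcal C^{\nu-1,1}(\mathcal Z)}\le C_p$ for all $s'\in\mathcal S$. **Mildly Smooth MDP of order $\nu$:** for every $h$, $\mathcal T_h$ is bounded from $L^\infty(\mathcal Z)$ to $\mathcal C^\nu(\mathcal Z)$, i.e. there is $C_{\mathcal T}<\infty$ with $\|\mathcal T_hf\|_{\mathcal C^\nu}\le C_{\mathcal T}(\|f\|_{L^\infty}+1)$ for all $h$ and $f\in L^\infty(\mathcal Z)$. *)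

(* Defs.v *)
From HB Require Import structures.
From mathcomp Require Import all_boot all_order all_algebra.
From mathcomp Require Import all_classical all_reals all_analysis.

Set Implicit Arguments.
Unset Strict Implicit.
Unset Printing Implicit Defensive.
Import Order.TTheory GRing.Theory Num.Theory.
Import numFieldNormedType.Exports.

Local Open Scope classical_set_scope.
Local Open Scope ring_scope.

(* Matrices carry the product sigma-algebra, i.e., the one generated by the
   entries. For ['rV[R]_n] with [R : realType] it is the Borel sigma-algebra. *)
Definition measure_matrix_display : measure_display -> measure_display.
Proof. exact. Qed.

Section measurable_matrix.
Context d (T : measurableType d) (m n : nat).

Definition matrix_cylinders : set (set 'M[T]_(m, n)) :=
  \bigcup_(ij in [set: 'I_m * 'I_n])
    preimage_set_system setT (fun A : 'M[T]_(m, n) => A ij.1 ij.2) measurable.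

Let matrix_set0 : <<s matrix_cylinders >> set0.
Proof. exact: sigma_algebra0. Qed.

Let matrix_setC A :
  <<s matrix_cylinders >> A -> <<s matrix_cylinders >> (~` A).
Proof. exact: sigma_algebraC. Qed.

Let matrix_bigcup (F : (set 'M[T]_(m, n))^nat) :
  (forall i, <<s matrix_cylinders >> (F i)) ->
  <<s matrix_cylinders >> (\bigcup_i F i).
Proof. exact: sigma_algebra_bigcup. Qed.

HB.instance Definition _ := @isMeasurable.Build (measure_matrix_display d)
  'M[T]_(m, n) <<s matrix_cylinders >> matrix_set0 matrix_setC matrix_bigcup.

Lemma measurable_entry (i : 'I_m) (j : 'I_n) :
  measurable_fun [set: 'M[T]_(m, n)] (fun A : 'M[T]_(m, n) => A i j).
Proof.
move=> _ B mB; apply: sub_sigma_algebra; exists (i, j) => //.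
by exists B.
Qed.

Lemma measurable_matrixP d' (T' : measurableType d') (f : T' -> 'M[T]_(m, n)) :
  (forall i j, measurable_fun [set: T'] (fun x => f x i j)) ->
  measurable_fun [set: T'] f.
Proof.
move=> mf _ A mA; rewrite setTI.
suff : <<s matrix_cylinders >> `<=` image_set_system setT f measurable.
  by move=> /(_ _ mA); rewrite /image_set_system /= setTI.
apply: smallest_sub; first exact/sigma_algebra_image/sigma_algebra_measurable.
move=> _ [[i j] _ [B mB <-]]; rewrite /image_set_system /= !setTI.
by have := mf i j measurableT B mB; rewrite setTI.
Qed.

End measurable_matrix.

(* Lebesgue measure on ['rV[R]_n], by recursion on the dimension. *)
Section lebesgue_row.
Context {R : realType}.

Section step.
Context (n : nat) (mu : {sigma_finite_measure set 'rV[R]_n -> \bar R}).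

Definition row_cons (u : measurableTypeR R * 'rV[R]_n) : 'rV[R]_n.+1 :=
  row_mx (u.1 : R)%:M u.2 : 'rV[R]_(1 + n).

Definition row_uncons (v : 'rV[R]_n.+1) : measurableTypeR R * 'rV[R]_n :=
  (v 0 0, rsubmx (v : 'rV[R]_(1 + n))).

Lemma row_consK : cancel row_cons row_uncons.
Proof.
move=> [x v]; rewrite /row_uncons /row_cons/= row_mxKr; congr pair.
rewrite (_ : 0 = @lshift 1 n 0 :> 'I_n.+1); last exact/val_inj.
by rewrite (@row_mxEl _ 1 1 n) mxE eqxx mulr1n.
Qed.

Lemma measurable_row_cons : measurable_fun setT row_cons.
Proof.
refine (@measurable_matrixP _ R 1 n.+1 _ _ row_cons _) => i j; rewrite ord1 {i}.
rewrite /row_cons; case: (@split_ordP 1 n j) => k ->.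
  under eq_fun do rewrite (@row_mxEl _ 1 1 n) ord1 mxE eqxx mulr1n.
  exact: measurable_fst.
under eq_fun do rewrite (@row_mxEr _ 1 1 n).
exact: (measurableT_comp (@measurable_entry _ R 1 n 0 k)
  (@measurable_snd _ _ (measurableTypeR R) 'rV[R]_n)).
Qed.

HB.instance Definition _ :=
  isMeasurableFun.Build _ _ _ _ row_cons measurable_row_cons.

Lemma measurable_row_uncons : measurable_fun setT row_uncons.
Proof.
apply: measurable_fun_pair; first exact: measurable_entry.
refine (@measurable_matrixP _ R 1 n _ _ _ _) => i j; under eq_fun do rewrite mxE.
exact: measurable_entry.
Qed.

Definition lebesgue_step : set 'rV[R]_n.+1 -> \bar R :=
  pushforward (@lebesgue_measure R \x mu)%E row_cons.

Let lebesgue_step0 : lebesgue_step set0 = 0%E.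
Proof. by rewrite /lebesgue_step /pushforward preimage_set0 measure0. Qed.

Let lebesgue_step_ge0 A : (0 <= lebesgue_step A)%E.
Proof. exact: measure_ge0. Qed.

Let lebesgue_step_sigma_additive : semi_sigma_additive lebesgue_step.
Proof.
exact: measure_semi_sigma_additive.
Qed.

HB.instance Definition _ := isMeasure.Build _ _ _ lebesgue_step
  lebesgue_step0 lebesgue_step_ge0 lebesgue_step_sigma_additive.

Let lebesgue_step_sigma_finite : sigma_finite setT lebesgue_step.
Proof.
have [F FT Ffin] : sigma_finite setT (@lebesgue_measure R \x mu)%E.
  have /sigma_finiteP[A [TA ndA Aoo]] := sigma_finiteT (@lebesgue_measure R).
  have /sigma_finiteP[B [TB ndB Boo]] := sigma_finiteT mu.
  exists (fun k => A k `*` B k).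
    rewrite -setXTT TA TB predeqE => -[x y]; split.
      move=> [/= [k _ Akx] [l _ Bly]]; exists (maxn k l) => //; split.
      - by move: x Akx; exact/subsetPset/ndA/leq_maxl.
      - by move: y Bly; exact/subsetPset/ndB/leq_maxr.
    by move=> [k _ []/= ? ?]; split; exists k.
  move=> k; have [mA Ak] := Aoo k; have [mB Bk] := Boo k.
  split; first exact: measurableX.
  by rewrite product_measure1E// lte_mul_pinfty// ge0_fin_numE.
exists (fun k => row_uncons @^-1` F k).
  by rewrite -preimage_bigcup -FT preimage_setT.
move=> k; have [mF Foo] := Ffin k; split.
  by rewrite -[X in measurable X]setTI; exact: measurable_row_uncons.
rewrite /lebesgue_step /pushforward -comp_preimage.
by rewrite (_ : _ \o _ = id) ?preimage_id//; apply/funext/row_consK.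
Qed.

HB.instance Definition _ := Measure_isSigmaFinite.Build _ _ _ lebesgue_step
  lebesgue_step_sigma_finite.

End step.

Fixpoint lebesgue_row n : {sigma_finite_measure set 'rV[R]_n -> \bar R} :=
  if n is k.+1 then lebesgue_step (lebesgue_row k)
  else (dirac (0 : 'rV[R]_0) : set 'rV[R]_0 -> \bar R).

End lebesgue_row.

(* The cube [-1, 1]^n. *)
Definition cube {R : realType} n : set 'rV[R]_n :=
  [set x | forall i, -1 <= x 0 i <= 1].
Arguments cube {R} n.

(* Functions on the cube are represented by total functions on ['rV[R]_n]; all
   the notions below only depend on the values taken on the cube. *)
Section holder.
Context {R : realType} {n : nat}.
Implicit Types (f : 'rV[R]_n -> R) (k : nat) (b L nu : R).

Definition quotient_cvg_filter (i : 'I_n) (x : 'rV[R]_n) : set_system R :=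
  within [set t | cube n (x + t *: delta_mx 0 i)] (0^').

Definition diff_quotient f (i : 'I_n) (x : 'rV[R]_n) (t : R) : R :=
  (f (x + t *: delta_mx 0 i) - f x) / t.

(* Partial derivatives relative to the cube: x + t e_i stays in the cube, so
   that they are one-sided on the faces orthogonal to e_i and agree with
   ['D_(delta_mx 0 i) f x] at interior points. *)
Definition partial (i : 'I_n) f (x : 'rV[R]_n) : R :=
  lim (diff_quotient f i x t @[t --> quotient_cvg_filter i x]).

Definition partially_derivable (i : 'I_n) f : Prop := forall x, cube n x ->
  cvg (diff_quotient f i x t @[t --> quotient_cvg_filter i x]).

Fixpoint continuously_differentiable k f : Prop :=
  {within cube n, continuous f} /\
  if k is k'.+1 then
    forall i, partially_derivable i f /\
              continuously_differentiable k' (partial i f)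
  else True.

(* D^alpha. The order of the partial derivatives is immaterial for
   |alpha|-times continuously differentiable functions. *)
Definition multi_partial (alpha : {ffun 'I_n -> nat}) f : 'rV[R]_n -> R :=
  foldr (fun i g => iter (alpha i) (partial i) g) f (enum 'I_n).

Definition multi_order (alpha : {ffun 'I_n -> nat}) : nat :=
  (\sum_(i < n) alpha i)%N.

(* Supremum norm over the cube. For continuous functions it is the essential
   supremum norm. *)
Definition sup_norm f : \bar R := ereal_sup [set `|f x|%:E | x in cube n].

(* [`|x - y|] is the max norm. *)
Definition is_holder_constant k b f L : Prop :=
  0 <= L /\ forall alpha, multi_order alpha = k ->
    forall x y, cube n x -> cube n y ->
      `|multi_partial alpha f x - multi_partial alpha f y| <=
        L * `|x - y| `^ b.

Definition holder_space k b f : Prop :=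
  continuously_differentiable k f /\ exists L, is_holder_constant k b f L.

Definition holder_constant k b f : \bar R :=
  ereal_inf [set L%:E | L in is_holder_constant k b f].

Definition holder_norm k b f : \bar R :=
  maxe (ereal_sup [set sup_norm (multi_partial alpha f)
                    | alpha in [set alpha | (multi_order alpha <= k)%N]])
       (holder_constant k b f).

Definition nu_star nu : nat := `|Num.ceil (nu - 1)|%N.

(* The space C^nu and its norm, for nu > 0. For nu = (k + 1)%:R they are
   [holder_space k 1] and [holder_norm k 1], i.e., C^{k,1}. *)
Definition C_space nu f : Prop :=
  holder_space (nu_star nu) (nu - (nu_star nu)%:R) f.

Definition C_norm nu f : \bar R :=
  holder_norm (nu_star nu) (nu - (nu_star nu)%:R) f.

End holder.

(* State-action pairs (s, a) are encoded as [row_mx s a]. Transition kernels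
   are defined on the ambient space but only matter for z in Z = [-1, 1]^d, for
   which they are concentrated on S = [-1, 1]^dS; a kernel from Z to S always
   has such an extension. *)
Record mdp (R : realType) (dS dA H : nat) := Mdp {
  reward : 'I_H -> 'rV[R]_(dS + dA) -> R ;
  transition : 'I_H -> R.-pker 'rV[R]_(dS + dA) ~> 'rV[R]_dS ;
  transition_cube : forall h z, cube (dS + dA) z ->
    transition h z (cube dS) = 1%E }.

Section smooth_mdp.
Context {R : realType} {dS dA H : nat}.
Implicit Types M : mdp R dS dA H.

(* The integral of a function that is not Borel is, on its positive and
   negative parts, the supremum of the integrals of the simple functions below
   it. For Borel f, the supremum over actions is universally measurable, and its
   integral is the one given by the completion of the kernel. *)
Definition bellman M (h : 'I_H) (f : 'rV[R]_(dS + dA) -> R)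
    (z : 'rV[R]_(dS + dA)) : R :=
  reward M h z +
  \int[transition M h z]_(s in cube dS)
    sup [set f (row_mx s a) | a in cube dA].

Definition is_density (mu : {measure set 'rV[R]_dS -> \bar R})
    (q : 'rV[R]_dS -> R) : Prop :=
  [/\ measurable_fun (cube dS) q,
      forall s, cube dS s -> 0 <= q s &
      forall A, measurable A ->
        mu A = (\int[lebesgue_row dS]_(s in A `&` cube dS) (q s)%:E)%E].

(* [strongly_smooth k] is k-Strong Smoothness, stated with C^{k,1}. *)
Definition strongly_smooth (k : nat) M : Prop :=
  exists p : 'I_H -> 'rV[R]_dS -> 'rV[R]_(dS + dA) -> R,
    (forall h z, cube (dS + dA) z ->
       is_density (transition M h z) (fun s => p h s z)) /\
    exists Cr Cp : R, forall h,
      (holder_space k 1 (reward M h) /\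
       (holder_norm k 1 (reward M h) <= Cr%:E)%E) /\
      (forall s, cube dS s ->
         holder_space k 1 (p h s) /\ (holder_norm k 1 (p h s) <= Cp%:E)%E).

(* The operator takes pointwise suprema over actions, so that it acts on
   bounded measurable functions with the supremum norm, not on classes modulo
   null sets. *)
Definition Linfty (f : 'rV[R]_(dS + dA) -> R) : Prop :=
  measurable_fun (cube (dS + dA)) f /\ (sup_norm f < +oo)%E.

Definition mildly_smooth (nu : R) M : Prop :=
  exists CT : R, forall h f, Linfty f ->
    C_space nu (bellman M h f) /\
    (C_norm nu (bellman M h f) <= CT%:E * (sup_norm f + 1))%E.

End smooth_mdp.

(* Main.v *)
(* The supremum over actions need not be measurable, but its lower integral
   against a measure dominated by Lebesgue measure is that of a measurable
   envelope G which only depends on Lebesgue measure. Hence T_h f(z) is, on the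
   cube, r_h(z) plus the integral over s' of G(s') p_h(s'|z), and z now occurs
   only in the smooth density.

   Bounds on D^alpha p_h(s'|.) that are uniform in s' yield, by the mean value
   theorem, first order Taylor expansions of each derivative of order < k = nu - 1
   with a remainder K t^2 that is uniform in s'. For the derivatives of order k - 1
   the remainder is controlled by the Lipschitz constant of those of order k. Such
   expansions can be integrated against G, and they characterize derivatives, so
   that no dominated convergence is needed.

   The norm only bounds the derivatives D^alpha, i.e., those taken in a fixed order
   of the coordinates, whereas continuous differentiability involves all orders:
   Schwarz's theorem on the closed cube makes up for it. *)

Require Import Defs.
From mathcomp Require Import all_boot all_order all_algebra.
From mathcomp Require Import all_classical all_reals all_analysis.
From mathcomp Require Import measurable_realfun ring lra.

Set Implicit Arguments.
Unset Strict Implicit.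
Unset Printing Implicit Defensive.
Import Order.TTheory GRing.Theory Num.Theory.
Import numFieldNormedType.Exports.

Local Open Scope classical_set_scope.
Local Open Scope ring_scope.

(** * Partial derivatives relative to the cube *)

Section cube_calculus.
Context {R : realType} {n : nat}.
Implicit Types (i j : 'I_n) (x y : 'rV[R]_n) (f g : 'rV[R]_n -> R) (s t : R).

Local Notation e i := (delta_mx 0 i : 'rV[R]_n).

Lemma row_shiftE i x t j : (x + t *: e i) 0 j = x 0 j + t *+ (j == i).
Proof. by rewrite !mxE eqxx /= mulr_natr. Qed.

Lemma cube_shift i x t : cube n x ->
  cube n (x + t *: e i) <-> -1 <= x 0 i + t <= 1.
Proof.
move=> cx; split=> [/(_ i)|ht j]; first by rewrite row_shiftE eqxx mulr1n.
rewrite row_shiftE; case: eqP => [->|_]; first by rewrite mulr1n.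
by rewrite mulr0n addr0; exact: cx.
Qed.

Lemma cube_between i x s t : cube n x -> cube n (x + t *: e i) ->
  0 <= s <= t -> cube n (x + s *: e i).
Proof.
move=> cx /(cube_shift _ _ cx) ht hs; apply/cube_shift => //.
by have := cx i; lra.
Qed.

(* Steps that stay in the cube: they make [quotient_cvg_filter] proper, and turn
   [partial] into the limit of a sequence. *)
Definition inward_step i x (m : nat) : R :=
  (if x 0 i <= 0 then 1 else -1) * m.+1%:R^-1.

Lemma inward_step_neq0 i x m : inward_step i x m != 0.
Proof.
by rewrite mulf_neq0 ?invr_eq0//; case: ifP => // _; rewrite oppr_eq0 oner_eq0.
Qed.

Lemma cube_inward_step i x m : cube n x ->
  cube n (x + inward_step i x m *: e i).
Proof.
move=> cx; apply/cube_shift => //; rewrite /inward_step.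
have : 0 < (m.+1%:R^-1 : R) <= 1 by rewrite invr_gt0 ltr0n/= invf_le1 ?ltr0n// ler1n.
move: (m.+1%:R^-1) => r hr.
by have := cx i; case: ifPn; rewrite -?ltNge ?mulN1r ?mul1r => h1 h2; lra.
Qed.

Lemma cvg_inward_step i x : cube n x ->
  inward_step i x m @[m --> \oo] --> quotient_cvg_filter i x.
Proof.
move=> cx A; rewrite /quotient_cvg_filter /within/= => hA.
have h0 : inward_step i x m @[m --> \oo] --> (0 : R).
  by rewrite -(mulr0 (if x 0 i <= 0 then 1 else -1)); apply: cvgMr; exact: cvg_harmonic.
have : \forall m \near \oo, (fun t => t != 0 -> cube n (x + t *: e i) -> A t)
   (inward_step i x m).
  exact: (h0 _ hA).
apply: filterS => m /= /(_ (inward_step_neq0 i x m)); apply.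
exact: cube_inward_step.
Qed.

Lemma quotient_cvg_proper i x : cube n x ->
  ProperFilter (quotient_cvg_filter i x).
Proof.
move=> cx; rewrite /quotient_cvg_filter; split; last exact: within_filter.
by move=> /(cvg_inward_step (i := i) cx) h; have /filter_ex [] := h.
Qed.

Lemma near_quotient i x (P : R -> Prop) (d : R) : 0 < d ->
  (forall t, t != 0 -> `|t| <= d -> cube n (x + t *: e i) -> P t) ->
  \forall t \near quotient_cvg_filter i x, P t.
Proof.
move=> d0 h; rewrite /quotient_cvg_filter /within /dnbhs /=.
have := @nbhs0_le R R d d0.
by apply: filterS => t td t0 ct; apply: h.
Qed.

Lemma near_quotientP i x (P : R -> Prop) :
  (\forall t \near quotient_cvg_filter i x, P t) -> exists2 d : R, 0 < d &
  forall t, t != 0 -> `|t| <= d -> cube n (x + t *: e i) -> P t.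
Proof.
rewrite /quotient_cvg_filter /within /dnbhs /= => /nbhs_ballP[d /= d0 h].
exists (d / 2); first by rewrite divr_gt0.
move=> t t0 td ct; apply: h => //.
by rewrite /ball/= sub0r normrN (le_lt_trans td)// ltr_pdivrMr// ltr_pMr// ltr1n.
Qed.

Lemma near_dnbhs0 (P : R -> Prop) (d : R) : 0 < d ->
  (forall t, t != 0 -> `|t| <= d -> P t) -> \forall t \near 0^', P t.
Proof.
move=> d0 h; rewrite /dnbhs /within /=.
by have := @nbhs0_le R R d d0; apply: filterS => t td t0; exact: h.
Qed.

Lemma partial_cvg i x f : cube n x -> partially_derivable i f ->
  diff_quotient f i x t @[t --> quotient_cvg_filter i x] --> partial i f x.
Proof. by move=> cx /(_ _ cx). Qed.

Lemma cvg_partial i x f l : cube n x ->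
  diff_quotient f i x t @[t --> quotient_cvg_filter i x] --> l ->
  partial i f x = l.
Proof.
move=> cx h; have pf := quotient_cvg_proper i cx.
exact: (cvg_lim (@Rhausdorff R) h).
Qed.

Lemma near_eq_diff_quotient i x f g : {in cube n, f =1 g} -> cube n x ->
  {near quotient_cvg_filter i x, diff_quotient f i x =1 diff_quotient g i x}.
Proof.
move=> fg cx; apply: (near_quotient ltr01) => t _ _ ct.
by rewrite /diff_quotient !fg ?inE.
Qed.

Lemma eq_partial i f g : {in cube n, f =1 g} ->
  {in cube n, partial i f =1 partial i g}.
Proof.
move=> fg x; rewrite inE => cx; have pf := quotient_cvg_proper i cx.
congr (lim _); apply/seteqP.
split; apply: (@near_eq_cvg _ _ (quotient_cvg_filter i x)).
  by apply: near_eq_diff_quotient => // y yc; rewrite fg.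
by apply: near_eq_diff_quotient => // y yc; rewrite fg.
Qed.

Lemma taylor_cvg i x f l (K : R) : cube n x ->
  (forall t, cube n (x + t *: e i) ->
    `|f (x + t *: e i) - f x - t * l| <= K * t ^+ 2) ->
  diff_quotient f i x t @[t --> quotient_cvg_filter i x] --> l.
Proof.
move=> cx hK; apply/cvgrPdist_le => eps eps0.
(* No sign is assumed on [K]; [|K| + 1] is positive, so that one can divide by it. *)
have K0 : 0 < `|K| + 1 by rewrite ltr_wpDl.
have d0 : 0 < (`|K| + 1)^-1 * eps by rewrite mulr_gt0 ?invr_gt0.
apply: (near_quotient d0) => t t0 td ct; rewrite /diff_quotient.
have t00 : 0 < `|t| by rewrite normr_gt0.
rewrite distrC -(ler_pM2r t00) -normrM.
rewrite (_ : (_ - l) * t = f (x + t *: e i) - f x - t * l); last first.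
  by rewrite mulrBl mulfVK// (mulrC l).
apply: le_trans (hK t ct) _; rewrite -real_normK ?num_real// expr2 mulrA ler_pM2r//.
apply: (@le_trans _ _ ((`|K| + 1) * `|t|)).
  by rewrite ler_wpM2r// (le_trans (ler_norm _))// lerDl.
by rewrite -ler_pdivlMl.
Qed.

Lemma norm_shift_le i t : `|t *: e i| <= `|t|.
Proof.
rewrite normrZ ler_piMr// /Num.Def.normr/= mx_normrE; apply: bigmax_le => //.
by move=> [j k] _ /=; rewrite mxE; case: (_ && _); rewrite ?normr1 ?normr0.
Qed.

Lemma norm_entry_le x j : `|x 0 j| <= `|x|.
Proof.
by rewrite [leRHS]/Num.Def.normr/= mx_normrE; apply/bigmax_geP; right; exists (0, j).
Qed.

Lemma continuous_shift i x : continuous (fun t => x + t *: e i).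
Proof.
move=> s; apply/cvgrPdist_le => eps eps0; near=> t.
rewrite opprD addrACA subrr add0r -scalerBl (le_trans (norm_shift_le i _))//.
Unshelve. all: by end_near. Qed.

Lemma continuous_line i x t f : {within cube n, continuous f} ->
  cube n x -> cube n (x + t *: e i) ->
  {within `[0, t], continuous (fun s => f (x + s *: e i))}.
Proof.
move=> /subspace_continuousP cf cx ct; apply/subspace_continuousP => s.
rewrite /= in_itv/= => hs.
have cs := cube_between cx ct hs.
apply: (@cvg_comp _ _ _ (fun r => x + r *: e i) f _
  (within (cube n) (nbhs (x + s *: e i))) _ _ (cf _ cs)) => A.
rewrite /within/= => hA.
have := @continuous_shift i x s _ hA.
apply: (@filterS _ (nbhs s)) => r hr.
by rewrite in_itv/= => ?; apply: hr; exact: (cube_between cx ct).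
Qed.

(** Inside the open segment, small steps of both signs stay in the cube, so the derivative relative
    to the cube is an ordinary derivative along the line and the classical mean value theorem
    applies. *)
Lemma mvt_partial_pos i x t f : {within cube n, continuous f} ->
  partially_derivable i f -> cube n x -> cube n (x + t *: e i) -> 0 < t ->
  exists2 s, 0 < s < t & f (x + t *: e i) - f x = t * partial i f (x + s *: e i).
Proof.
move=> cf df cx ct t0.
pose g s := f (x + s *: e i).
have dg s : s \in `]0, t[ -> is_derive s 1 g (partial i f (x + s *: e i)).
  rewrite in_itv/= => hs.
  have cs : cube n (x + s *: e i) by apply: (cube_between cx ct); lra.
  have quot : h^-1 *: ((g \o shift s) (h *: 1) - g s) @[h --> 0^'] -->
      partial i f (x + s *: e i).
    apply/cvgrPdist_le => eps eps0.
    have /cvgrPdist_le/(_ eps eps0) := partial_cvg cs df.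
    move=> /near_quotientP[d d0 hd].
    (* A step h bounded by s and t - s keeps s + h in [0, t], hence the shifted point in the
       cube. *)
    have m0 : 0 < Num.min d (Num.min s (t - s)) by rewrite !lt_min d0; lra.
    apply: (near_dnbhs0 m0) => h h0; rewrite !le_min => /and3P[hd1 hst hst'].
    have -> : h^-1 *: ((g \o shift s) (h *: 1) - g s) =
        diff_quotient f i (x + s *: e i) h.
      rewrite /diff_quotient /g /= -addrA -scalerDl (addrC s) [_ *: 1]mulr1.
      by rewrite mulrC.
    apply: hd => //; rewrite -addrA -scalerDl.
    apply: (cube_between cx ct); move: hst hst'; rewrite !ler_norml; lra.
  by split; [apply/cvgP; exact: quot|exact: cvg_lim quot].
have [c] := MVT t0 dg (continuous_line cf cx ct).
rewrite in_itv/= subr0 /g scale0r addr0 => c0t ->; exists c => //.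
by rewrite mulrC.
Qed.

Lemma mvt_partial i x t f : {within cube n, continuous f} ->
  partially_derivable i f -> cube n x -> cube n (x + t *: e i) ->
  exists s, [/\ `|s| <= `|t|, cube n (x + s *: e i) &
    f (x + t *: e i) - f x = t * partial i f (x + s *: e i)].
Proof.
move=> cf df cx ct; case: (ltgtP t 0) => [t0|t0|->]; last first.
- by exists 0; rewrite scale0r addr0 subrr mul0r normr0.
- have [s /andP[s0 st] fE] := mvt_partial_pos cf df cx ct t0.
  exists s; split=> //; first by rewrite !gtr0_norm// ltW.
  by apply: (cube_between cx ct); rewrite !ltW.
(* For t < 0 the segment is traversed from its other endpoint; a parameter s measured from there
   becomes t + s when measured from x. *)
- have xE : x = (x + t *: e i) + (- t) *: e i by rewrite scaleNr addrK.
  have cx' : cube n ((x + t *: e i) + (- t) *: e i) by rewrite -xE.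
  have t0' : 0 < - t by rewrite oppr_gt0.
  have [s /andP[s0 st] fE] := mvt_partial_pos cf df ct cx' t0'.
  exists (t + s); split.
  + by rewrite !ler0_norm; lra.
  + by rewrite scalerDl addrA; apply: (cube_between ct cx'); rewrite !ltW.
  + move: fE; rewrite -xE scalerDl addrA => fE.
    by rewrite -(opprB (f x)) fE mulNr opprK.
Qed.

(** By the mean value theorem, the remainder is t times the variation of the derivative over a step
    s with |s| <= |t|, whence the square. *)
Lemma taylor_partial i x t f (K : R) : {within cube n, continuous f} ->
  partially_derivable i f ->
  (forall s y, cube n y -> cube n (y + s *: e i) ->
    `|partial i f (y + s *: e i) - partial i f y| <= K * `|s|) ->
  0 <= K -> cube n x -> cube n (x + t *: e i) ->
  `|f (x + t *: e i) - f x - t * partial i f x| <= K * t ^+ 2.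
Proof.
move=> cf df hK K0 cx ct; have [s [st cs ->]] := mvt_partial cf df cx ct.
rewrite -mulrBr normrM -real_normK ?num_real// expr2 mulrCA ler_wpM2l//.
by rewrite (le_trans (hK _ _ cx cs))// ler_wpM2l.
Qed.

(** The coordinates are changed one at a time from those of y to those of x. The intermediate points
    stay in the cube, and each of the n steps has length at most |x - y|. *)
Lemma lipschitz_partials f (K : R) : {within cube n, continuous f} ->
  (forall i, partially_derivable i f) -> 0 <= K ->
  (forall i x, cube n x -> `|partial i f x| <= K) ->
  forall x y, cube n x -> cube n y -> `|f x - f y| <= n%:R * K * `|x - y|.
Proof.
move=> cf df K0 hK x y cx cy.
pose z (m : nat) : 'rV[R]_n := \row_j (if (j < m)%N then x 0 j else y 0 j).
have cz m : cube n (z m) by move=> j; rewrite mxE; case: ifP.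
have z0 : z 0 = y by apply/rowP => j; rewrite mxE.
have zn : z n = x by apply/rowP => j; rewrite mxE ltn_ord.
have zS (m : 'I_n) : z m.+1 = z m + (x 0 m - y 0 m) *: e m.
  apply/rowP => j; rewrite row_shiftE !mxE ltnS leq_eqVlt.
  rewrite -[(j == m :> nat)]/(j == m); case: eqP => [->|_] /=.
    by rewrite ltnn mulr1n addrC subrK.
  by rewrite mulr0n addr0.
rewrite -zn -z0 -(telescope_sumr (fun m => f (z m))) ?leq0n//.
rewrite big_mkord (le_trans (ler_norm_sum _ _ _))// zn z0.
have -> : n%:R * K * `|x - y| = \sum_(m < n) K * `|x - y|.
  by rewrite sumr_const card_ord -mulrA mulr_natl.
apply: ler_sum => m _.
have cS : cube n (z m + (x 0 m - y 0 m) *: e m) by rewrite -zS.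
have [s [_ cs]] := mvt_partial cf (df m) (cz m) cS.
rewrite -zS => ->; rewrite normrM mulrC ler_pM//; first exact: hK.
by rewrite (le_trans _ (norm_entry_le _ m))// !mxE.
Qed.

Lemma lipschitz_cube_continuous f (K : R) :
  (forall x y, cube n x -> cube n y -> `|f x - f y| <= K * `|x - y|) ->
  {within cube n, continuous f}.
Proof.
move=> hK; apply/subspace_continuousP => x cx.
have K0 : 0 < `|K| + 1 by rewrite ltr_wpDl.
apply/cvgrPdist_le => eps eps0; rewrite /within /=.
have d0 : 0 < (`|K| + 1)^-1 * eps by rewrite mulr_gt0 ?invr_gt0.
apply/nbhs_ballP; exists ((`|K| + 1)^-1 * eps) => //= y.
rewrite mx_norm_ball /ball_/= => xy cy.
rewrite (le_trans (hK _ _ cx cy))//.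
rewrite (@le_trans _ _ ((`|K| + 1) * `|x - y|))//.
  by rewrite ler_wpM2r// (le_trans (ler_norm _))// lerDl.
by rewrite -ler_pdivlMl// ltW.
Qed.

End cube_calculus.

(** * Symmetry of second derivatives *)

Section schwarz.
Context {R : realType} {n : nat}.
Implicit Types (i j : 'I_n) (x y : 'rV[R]_n) (f g : 'rV[R]_n -> R) (s t : R).

Local Notation e i := (delta_mx 0 i : 'rV[R]_n).

Lemma cube_continuous_dist f x (eps : R) : {within cube n, continuous f} ->
  cube n x -> 0 < eps -> exists2 d : R, 0 < d &
    forall y, cube n y -> `|x - y| < d -> `|f x - f y| <= eps.
Proof.
move=> /subspace_continuousP cf cx eps0.
have /cvgrPdist_le/(_ eps eps0) := cf x cx.
rewrite /within /= => /nbhs_ballP[d /= d0]; rewrite mx_norm_ball /ball_ => h.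
by exists d => // y cy xy; apply: h.
Qed.

Definition set_coord j (c : R) x : 'rV[R]_n := x + (c - x 0 j) *: e j.

Lemma set_coordE j c x k :
  set_coord j c x 0 k = if k == j then c else x 0 k.
Proof.
rewrite /set_coord row_shiftE; case: eqP => [->|_]; last by rewrite mulr0n addr0.
by rewrite mulr1n addrC subrK.
Qed.

Lemma set_coord_shift i j c x t : i != j ->
  set_coord j c (x + t *: e i) = set_coord j c x + t *: e i.
Proof.
move=> ij; apply/rowP => k; rewrite [RHS]row_shiftE !set_coordE row_shiftE.
by case: eqP => [->|//]; rewrite eq_sym (negbTE ij) addr0.
Qed.

Lemma cube_set_coord j c x : -1 <= c <= 1 -> cube n x ->
  cube n (set_coord j c x).
Proof. by move=> hc cx k; rewrite set_coordE; case: eqP. Qed.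

Lemma set_coord_dist j c x y : `|set_coord j c x - set_coord j c y| <= `|x - y|.
Proof.
rewrite [leLHS]/Num.Def.normr/= mx_normrE; apply: bigmax_le => // -[a k] _ /=.
have subE (A B : 'rV[R]_n) : (A - B) 0 k = A 0 k - B 0 k by rewrite !mxE.
rewrite ord1 subE !set_coordE; case: eqP => _; first by rewrite subrr normr0.
by rewrite -subE; exact: norm_entry_le.
Qed.

Lemma set_coord_continuous j c f : -1 <= c <= 1 ->
  {within cube n, continuous f} ->
  {within cube n, continuous (f \o set_coord j c)}.
Proof.
move=> hc cf; apply/subspace_continuousP => x cx; apply/cvgrPdist_le => eps eps0.
have [d d0 hd] := cube_continuous_dist cf (cube_set_coord j hc cx) eps0.
rewrite /within /=; apply/nbhs_ballP; exists d => //= y.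
rewrite mx_norm_ball /ball_/= => xy cy; apply: hd; first exact: cube_set_coord.
exact: le_lt_trans (set_coord_dist _ _ _ _) xy.
Qed.

(** As i differs from j, [set_coord j c] commutes with steps along e_i and keeps the i-th
    coordinate, so the same steps are admissible at both points. *)
Lemma set_coord_partial_cvg i j c f x : i != j -> -1 <= c <= 1 ->
  partially_derivable i f -> cube n x ->
  diff_quotient (f \o set_coord j c) i x t @[t --> quotient_cvg_filter i x] -->
  partial i f (set_coord j c x).
Proof.
move=> ij hc df cx; have cx' := cube_set_coord j hc cx.
have := partial_cvg cx' df.
have -> : quotient_cvg_filter i (set_coord j c x) = quotient_cvg_filter i x.
  rewrite /quotient_cvg_filter.
  suff -> : [set t | cube n (set_coord j c x + t *: e i)] =
            [set t | cube n (x + t *: e i)] by [].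
  have cE : set_coord j c x 0 i = x 0 i by rewrite set_coordE (negbTE ij).
  apply/seteqP; split=> t /= ht.
    by apply/cube_shift; rewrite // -cE; apply/cube_shift.
  by apply/cube_shift; rewrite // cE; apply/cube_shift.
by under [X in _ -> X @ _ --> _]eq_fun do rewrite /diff_quotient/= set_coord_shift//.
Qed.

(* The mean value theorem is applied to functions that are defined on the whole
   cube, hence the detour by [set_coord] instead of a shift by [k *: e j]. *)
Lemma second_difference i j x h k f : i != j ->
  {within cube n, continuous f} -> partially_derivable i f ->
  {within cube n, continuous (partial i f)} ->
  partially_derivable j (partial i f) ->
  cube n x -> cube n (x + h *: e i) -> cube n (x + k *: e j) ->
  exists y, [/\ cube n y, `|x - y| <= `|h| + `|k| &
    f (x + h *: e i + k *: e j) - f (x + h *: e i) - (f (x + k *: e j) - f x) =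
    h * (k * partial j (partial i f) y)].
Proof.
move=> ij cf df cdf ddf cx ch ck.
have hk : -1 <= x 0 j + k <= 1 by apply/cube_shift.
have h0 : -1 <= x 0 j <= 1 by apply: cx.
(* The slices of f at heights x_j + k and x_j, both pulled back to the whole cube. The increment of
   g from x to x + h e_i is the second difference. *)
pose g := (f \o set_coord j (x 0 j + k)) \- (f \o set_coord j (x 0 j)).
have up : set_coord j (x 0 j + k) x = x + k *: e j.
  by rewrite /set_coord [_ + k]addrC addrK.
have down : set_coord j (x 0 j) x = x.
  by rewrite /set_coord subrr scale0r addr0.
have gE t : g (x + t *: e i) =
    f (x + t *: e i + k *: e j) - f (x + t *: e i).
  by rewrite /g /= !set_coord_shift// up down addrAC.
have cg : {within cube n, continuous g}.
  apply/subspace_continuousP => y cy; apply: cvgB.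
    by have /subspace_continuousP := set_coord_continuous (j := j) hk cf; apply.
  by have /subspace_continuousP := set_coord_continuous (j := j) h0 cf; apply.
pose dg y := partial i f (set_coord j (x 0 j + k) y) - partial i f (set_coord j (x 0 j) y).
have cvg_dg y : cube n y ->
    diff_quotient g i y t @[t --> quotient_cvg_filter i y] --> dg y.
  move=> cy; have pf := quotient_cvg_proper i cy.
  have -> : diff_quotient g i y =
      diff_quotient (f \o set_coord j (x 0 j + k)) i y \-
      diff_quotient (f \o set_coord j (x 0 j)) i y.
    by apply/funext => t; rewrite /diff_quotient /g /= -mulrBl; congr (_ / _); ring.
  by apply: cvgB; exact: set_coord_partial_cvg.
have pg : partially_derivable i g by move=> y cy; apply/cvgP; exact: cvg_dg.
have [s [hs cs gdiff]] := mvt_partial cg pg cx ch.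
move: gdiff; rewrite -{2}(addr0 x) -(scale0r (e i)) !gE scale0r addr0 => ->.
rewrite (cvg_partial cs (cvg_dg _ cs)) /dg !set_coord_shift// up down addrAC.
have cks : cube n (x + s *: e i + k *: e j).
  by apply/cube_shift => //; rewrite row_shiftE eq_sym (negbTE ij) addr0.
have [r [hr cr ->]] := mvt_partial cdf ddf cs cks.
exists (x + s *: e i + r *: e j); split=> //.
rewrite -addrA opprD addNKr normrN (le_trans (ler_normD _ _))// lerD//.
  exact: le_trans (norm_shift_le _ _) hs.
exact: le_trans (norm_shift_le _ _) hr.
Qed.

(** Both orders of differencing give the same second difference, hence equal mixed derivatives at
    two points y and z near x; continuity at x concludes. *)
Lemma partialC i j f : {within cube n, continuous f} ->
  (forall k, partially_derivable k f) ->
  (forall k, {within cube n, continuous (partial k f)}) ->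
  (forall k l, partially_derivable l (partial k f)) ->
  (forall k l, {within cube n, continuous (partial l (partial k f))}) ->
  {in cube n, partial j (partial i f) =1 partial i (partial j f)}.
Proof.
move=> cf df cdf ddf cddf x; rewrite inE => cx.
have [->//|ij] := eqVneq i j.
apply/eqP; rewrite -subr_eq0 -normr_le0; apply/ler_addgt0Pr => eps eps0.
have eps20 : 0 < eps / 2 by rewrite divr_gt0.
have [d d0 hd] := cube_continuous_dist (cddf i j) cx eps20.
have [d' d'0 hd'] := cube_continuous_dist (cddf j i) cx eps20.
(* Steps shorter than c place y and z within c + c of x, inside both continuity radii. *)
have [c [c0 cd cd']] : exists c : R, [/\ 0 < c, c + c <= d & c + c <= d'].
  exists (Num.min d d' / 2); split; first by rewrite divr_gt0// lt_min d0.
    by rewrite -splitr ge_min lexx.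
  by rewrite -splitr ge_min lexx orbT.
have small k : exists h : R, [/\ h != 0, cube n (x + h *: e k) & `|h| < c].
  have pk := quotient_cvg_proper k cx.
  have /filter_ex[h [h0 [ch hm]]] : \forall h \near quotient_cvg_filter k x,
      h != 0 /\ cube n (x + h *: e k) /\ `|h| < c.
    apply: (@near_quotient _ _ k x _ (c / 2)); first by rewrite divr_gt0.
    move=> h h0 hm ch; split=> //; split=> //; apply: (le_lt_trans hm).
    by rewrite ltr_pdivrMr// ltr_pMr// ltr1n.
  by exists h.
have [h [h0 ch hm]] := small i; have [k [k0 ck km]] := small j.
have [y [cy xy fy]] := second_difference ij cf (df i) (cdf i) (ddf i j) cx ch ck.
have ji : j != i by rewrite eq_sym.
have [z [cz xz fz]] := second_difference ji cf (df j) (cdf j) (ddf j i) cx ck ch.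
have yz : partial j (partial i f) y = partial i (partial j f) z.
  suff /(mulfI h0)/(mulfI k0) : h * (k * partial j (partial i f) y) =
    h * (k * partial i (partial j f) z) by [].
  rewrite [RHS]mulrCA -fy -fz (addrAC x (k *: e j)); ring.
have hkd := ltrD hm km.
have := hd _ cy (le_lt_trans xy (lt_le_trans hkd cd)).
rewrite [`|h| + _]addrC in hkd.
have := hd' _ cz (le_lt_trans xz (lt_le_trans hkd cd')).
rewrite yz add0r => le2 le1.
rewrite -(subrKA (partial i (partial j f) z)) (splitr eps).
apply: (le_trans (ler_normD _ _)); apply: lerD; first exact: le1.
by rewrite distrC; exact: le2.
Qed.

End schwarz.

(** * Functions with a uniform Taylor expansion *)

Section taylor_family.
Context {R : realType} {n : nat}.
Implicit Types (i j : 'I_n) (x y : 'rV[R]_n) (f g : 'rV[R]_n -> R) (s t : R).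
Implicit Types (u v w : seq 'I_n) (k : nat).

Local Notation e i := (delta_mx 0 i : 'rV[R]_n).

Definition partials w f : 'rV[R]_n -> R := foldr partial f w.

Lemma partials_cat u v f : partials (u ++ v) f = partials u (partials v f).
Proof. by rewrite /partials foldr_cat. Qed.

(** [continuously_differentiable] peels off the derivative taken first, which is the last letter of
    the word; hence the case analysis on w from its end. *)
Lemma continuous_partials k f w : continuously_differentiable k f ->
  (size w <= k)%N -> {within cube n, continuous (partials w f)}.
Proof.
elim: k f w => [|k IH] f w.
  by move=> [cf _]; rewrite leqn0 size_eq0 => /eqP ->.
case/lastP: w => [[] //|w i [_ /(_ i)[_ cdf]]].
by rewrite size_rcons ltnS -cats1 partials_cat; exact: IH.
Qed.

Lemma derivable_partials k f w i : continuously_differentiable k f ->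
  (size w < k)%N -> partially_derivable i (partials w f).
Proof.
elim: k f w => [//|k IH] f w; case/lastP: w => [[_ /(_ i)[]]//|w j [_ /(_ j)[_ cdf]]].
by rewrite size_rcons ltnS -cats1 partials_cat; exact: IH.
Qed.

(** Induction brings i in front of the tail of u; it is then exchanged with the head j by
    [partialC], applied to the derivative along the other letters. *)
Lemma partials_middle k f u i v : continuously_differentiable k f ->
  (size (u ++ i :: v) <= k)%N ->
  {in cube n, partials (u ++ i :: v) f =1 partials (i :: u ++ v) f}.
Proof.
move=> cdf; elim: u => [//|j u IH] /= sk x cx.
apply: etrans (eq_partial j (IH (ltnW sk)) cx) _; rewrite /=.
have su : ((size (u ++ v)).+2 <= k)%N.
  by move: sk; rewrite !size_cat /= addnS.
apply: (@partialC _ _ i j (partials (u ++ v) f)) => //.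
- by apply: continuous_partials cdf _; rewrite ltnW// ltnW.
- by move=> l; apply: derivable_partials cdf _; rewrite ltnW.
- by move=> l; apply: (@continuous_partials k f (l :: (u ++ v)) cdf); rewrite ltnW.
- by move=> l m; exact: (@derivable_partials k f (l :: (u ++ v)) m cdf).
- by move=> l m; exact: (@continuous_partials k f (m :: l :: (u ++ v)) cdf).
Qed.

(** The head of w is located in w' and pulled to the front by [partials_middle]; induction handles
    the tails. *)
Lemma perm_partials k f w w' : continuously_differentiable k f ->
  (size w <= k)%N -> perm_eq w w' ->
  {in cube n, partials w f =1 partials w' f}.
Proof.
move=> cdf; elim: w w' => [|i w IH] w' sw ww' x cx.
  by move: ww'; rewrite perm_sym => /perm_nilP ->.
have : i \in w' by rewrite -(perm_mem ww') mem_head.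
move=> /splitPr w'E; case: w'E ww' => u v ww'.
have wuv : perm_eq w (u ++ v).
  by rewrite -(perm_cons i) (perm_trans ww')// perm_catC /= perm_cons perm_catC.
rewrite (partials_middle cdf)//; last by rewrite -(perm_size ww').
by apply: eq_partial cx; apply: IH => //; exact: ltnW.
Qed.

Definition word (alpha : {ffun 'I_n -> nat}) : seq 'I_n :=
  flatten [seq nseq (alpha i) i | i <- enum 'I_n].

Lemma multi_partialE alpha f : multi_partial alpha f = partials (word alpha) f.
Proof.
rewrite /multi_partial /word; elim: (enum _) => //= i s ->.
rewrite partials_cat; by elim: (alpha i) => //= m ->.
Qed.

Lemma count_word alpha i : count_mem i (word alpha) = alpha i.
Proof.
rewrite /word count_flatten -map_comp sumnE big_map big_enum/=.
rewrite (bigD1 i)//= count_nseq /= eqxx mul1n big1 ?addn0// => j ji.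
by rewrite count_nseq /= (negbTE ji).
Qed.

Lemma size_word alpha : size (word alpha) = multi_order alpha.
Proof.
rewrite /word size_flatten /shape -map_comp sumnE big_map big_enum/=.
by apply: eq_bigr => j _; rewrite /= size_nseq.
Qed.

Definition letter_counts w : {ffun 'I_n -> nat} := [ffun i => count_mem i w].

(** Up to reordering, the derivative along any word is some D^alpha, the only kind that the Holder
    norm controls. *)
Lemma perm_word w : perm_eq w (word (letter_counts w)).
Proof.
by apply/allP => i _ /=; rewrite count_word ffunE.
Qed.

Lemma multi_order_letter_counts w : multi_order (letter_counts w) = size w.
Proof. by rewrite -size_word -(perm_size (perm_word w)). Qed.

(* [phi w] stands for the derivative along the word [w]. The conditions are
   pointwise inequalities, so that they are preserved by integration over a
   parameter. *)
Definition taylor_family k (K : R) (phi : seq 'I_n -> 'rV[R]_n -> R) :=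
  forall w, (size w <= k)%N ->
  [/\ forall x, cube n x -> `|phi w x| <= K,
      forall x y, cube n x -> cube n y -> `|phi w x - phi w y| <= K * `|x - y| &
      (size w < k)%N -> forall i x t, cube n x -> cube n (x + t *: e i) ->
        `|phi w (x + t *: e i) - phi w x - t * phi (i :: w) x| <= K * t ^+ 2].

Lemma cube0 : cube n (0 : 'rV[R]_n).
Proof. by move=> i; rewrite mxE; apply/andP; split; lra. Qed.

(** Reordering letters turns the bounds on the D^alpha into bounds on all words. Words of length k
    inherit the Holder constant as Lipschitz constant; shorter ones get theirs from the bounds on
    one more derivative. *)
Lemma holder_taylor_family k f (C : R) :
  holder_space k 1 f -> (holder_norm k 1 f <= C%:E)%E ->
  taylor_family k (n.+1%:R * (`|C| + 1)) (partials^~ f).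
Proof.
move=> [cdf _]; rewrite /holder_norm ge_max => /andP[supC lipC].
set K := `|C| + 1.
(* The 1 added in K makes C < K strict, so that some actual Holder constant L lies below K although
   [holder_constant] is an infimum. *)
have K0 : 0 <= K by rewrite addr_ge0.
have CK : C < K by rewrite (le_lt_trans (ler_norm C))// ltrDl.
have bnd w x : (size w <= k)%N -> cube n x -> `|partials w f x| <= K.
  move=> wk cx; rewrite (perm_partials cdf wk (perm_word w)) ?inE//.
  rewrite (le_trans _ (ltW CK))// -lee_fin (le_trans _ supC)//.
  apply: (@le_trans _ _ (sup_norm (multi_partial (letter_counts w) f))).
    by apply: ereal_sup_ubound; exists x; rewrite ?multi_partialE.
  apply: ereal_sup_ubound; exists (letter_counts w) => //=.
  by rewrite multi_order_letter_counts.
have lipk w x y : size w = k -> cube n x -> cube n y ->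
    `|partials w f x - partials w f y| <= K * `|x - y|.
  move=> wk cx cy; have wk' : (size w <= k)%N by rewrite wk.
  have : (holder_constant k 1 f < K%:E)%E by rewrite (le_lt_trans lipC)// lte_fin.
  move=> /ereal_inf_lt[_ [L [L0 /(_ (letter_counts w)) hL] <-]]; rewrite lte_fin => LK.
  rewrite !(perm_partials cdf wk' (perm_word w)) ?inE// -!multi_partialE.
  rewrite (le_trans (hL _ _ _ cx cy))//; first by rewrite multi_order_letter_counts.
  by rewrite powRr1// ler_wpM2r// ltW.
(* The factor n.+1 covers both the 1 for words of length k and the n of [lipschitz_partials]. *)
have lip w x y : (size w <= k)%N -> cube n x -> cube n y ->
    `|partials w f x - partials w f y| <= n.+1%:R * K * `|x - y|.
  rewrite leq_eqVlt => /predU1P[wk|wk] cx cy.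
    rewrite (le_trans (lipk _ _ _ wk cx cy))// ler_wpM2r// ler_peMl//.
    by rewrite ler1n.
  have cw := continuous_partials cdf (ltnW wk).
  have dw i := @derivable_partials k f w i cdf wk.
  rewrite (le_trans (lipschitz_partials cw dw K0 _ cx cy))//.
    by move=> i z cz; exact: (bnd (i :: w)).
  by rewrite !ler_wpM2r// ler_nat.
move=> w wk; split=> [x cx|x y|wk' i x t cx ct].
- by rewrite (le_trans (bnd _ _ wk cx))// ler_peMl// ler1n.
- exact: lip.
- apply: taylor_partial => //.
  + exact: continuous_partials cdf wk.
  + exact: derivable_partials cdf wk'.
  + move=> s y cy cs; rewrite (le_trans (lip (i :: w) _ _ wk' cs cy))//.
    rewrite ler_wpM2l ?mulr_ge0// addrAC subrr add0r; exact: norm_shift_le.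
  + by rewrite mulr_ge0.
Qed.

(** The expansion at the empty word identifies [partial i f] with the member at the word i. The
    members at [rcons w i] then form a family for [partial i f] with one order less, whence the
    induction on k. *)
Lemma taylor_family_cd k (K : R) phi f : taylor_family k K phi ->
  {in cube n, f =1 phi [::]} ->
  continuously_differentiable k f /\
  forall w, (size w <= k)%N -> {in cube n, partials w f =1 phi w}.
Proof.
elim: k phi f => [|k IH] phi f hphi fphi.
  split; last by move=> w; rewrite leqn0 size_eq0 => /eqP ->.
  split=> //; have [//|_ lip _] := hphi [::].
  apply: (@lipschitz_cube_continuous _ _ _ K) => x y cx cy.
  by rewrite !fphi ?inE//; exact: lip.
have cvg_quot i x : cube n x ->
    diff_quotient f i x t @[t --> quotient_cvg_filter i x] --> phi [:: i] x.
  move=> cx; have [//|_ _ tay] := hphi [::].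
  apply: (@taylor_cvg _ _ _ _ _ _ K) => // t ct.
  by rewrite !fphi ?inE//; exact: tay.
have hp i : {in cube n, partial i f =1 phi [:: i]}.
  by move=> x; rewrite inE => cx; exact: cvg_partial (cvg_quot i x cx).
have hphi' i : taylor_family k K (fun w => phi (rcons w i)).
  move=> w wk; have [|b l tay] := hphi (rcons w i); first by rewrite size_rcons.
  by split=> // wk'; apply: tay; rewrite size_rcons.
split.
  split.
    have [//|_ lip _] := hphi [::].
    apply: (@lipschitz_cube_continuous _ _ _ K) => x y cx cy.
    by rewrite !fphi ?inE//; exact: lip.
  move=> i; split; first by move=> x cx; apply/cvgP; exact: cvg_quot.
  by have [] := IH _ _ (hphi' i) (hp i).
move=> w; case/lastP: w => [//|w i]; rewrite size_rcons ltnS => wk x cx.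
rewrite -{1}cats1 partials_cat.
by have [_ /(_ w wk)] := IH _ _ (hphi' i) (hp i); apply.
Qed.

Lemma taylor_family_holder k (K : R) phi f : taylor_family k K phi ->
  {in cube n, f =1 phi [::]} ->
  holder_space k 1 f /\ (holder_norm k 1 f <= K%:E)%E.
Proof.
move=> hphi fphi; have [cdf pE] := taylor_family_cd hphi fphi.
have K0 : 0 <= K.
  by have [//|/(_ _ cube0) b _ _] := hphi [::]; exact: le_trans b.
have hK : is_holder_constant k 1 f K.
  split=> // alpha ak x y cx cy; rewrite powRr1// multi_partialE.
  have wk : (size (word alpha) <= k)%N by rewrite size_word ak.
  by rewrite !pE ?inE//; have [_ lip _] := hphi _ wk; exact: lip.
split; first by split=> //; exists K.
rewrite /holder_norm ge_max; apply/andP; split; last first.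
  by apply: ereal_inf_lbound; exists K.
apply: ge_ereal_sup => _ [alpha /= ak <-]; apply: ge_ereal_sup => _ [x cx <-].
have wk : (size (word alpha) <= k)%N by rewrite size_word.
rewrite lee_fin multi_partialE pE ?inE//.
by have [b _ _] := hphi _ wk; exact: b.
Qed.

End taylor_family.

(** * Lower integrals and densities *)

Section integral_nonmeasurable.
Context d (T : measurableType d) (R : realType).
Implicit Types (mu nu : {measure set T -> \bar R}) (D : set T).
Import HBNNSimple.
Local Open Scope ereal_scope.

(** For a nonnegative function, measurable or not, the integral is a supremum over the simple
    functions below it, a set that grows with the function. *)
Lemma le_integral_nonmeasurable mu (f g : T -> \bar R) :
  (forall x, 0 <= f x) -> (forall x, f x <= g x) ->
  \int[mu]_x f x <= \int[mu]_x g x.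
Proof.
move=> f0 fg; rewrite !ge0_integralTE//; last by move=> x; exact: le_trans (fg x).
by apply: le_ereal_sup => _ [h hf <-]; exists h => // x; exact: le_trans (fg x).
Qed.

Lemma integral_le_measurable_below mu (f : T -> \bar R) (c : \bar R) :
  (forall x, 0 <= f x) ->
  (forall h : {nnsfun T >-> R}, (forall x, (h x)%:E <= f x) ->
    \int[mu]_x (h x)%:E <= c) ->
  \int[mu]_x f x <= c.
Proof.
move=> f0 hc; rewrite ge0_integralTE//; apply: ge_ereal_sup => _ [h hf <-].
by rewrite -integralT_nnsfun; exact: hc.
Qed.

(* The supremum of a maximizing sequence of simple functions below [u] is,
   up to null sets, the largest measurable function below [u]. *)
Lemma measurable_lower_envelope mu D (u : T -> R) (B : R) :
  measurable D -> mu D < +oo -> (forall x, 0 <= u x <= B * \1_D x)%R ->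
  exists v : T -> R, [/\ measurable_fun setT v, forall x, (0 <= v x <= u x)%R &
    forall nu, nu `<< mu -> \int[nu]_x (u x)%:E = \int[nu]_x (v x)%:E].
Proof.
move=> mD muD uB.
have u0 x : (0 <= u x)%R by have /andP[] := uB x.
pose V := \int[mu]_x (u x)%:E.
pose S := [set sintegral mu h | h in [set h : {nnsfun T >-> R} |
  forall x, (h x)%:E <= (u x)%:E]].
have VE : V = ereal_sup S by rewrite /V ge0_integralTE// => x; rewrite lee_fin.
have Vfin : V \is a fin_num.
  rewrite ge0_fin_numE; last by apply: integral_ge0 => x _; rewrite lee_fin.
  (* V is finite because u is at most |B| on D, which has finite measure, and vanishes elsewhere. *)
  apply: (@le_lt_trans _ _ (\int[mu]_x (`|B|%:E * (\1_D x)%:E))).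
    apply: le_integral_nonmeasurable => x; first by rewrite lee_fin.
    have /andP[_ uBx] := uB x; rewrite -EFinM lee_fin (le_trans uBx)//.
    by rewrite ler_wpM2r// ler_norm.
  rewrite ge0_integralZl//; last exact/measurable_EFinP.
  by rewrite integral_indic// setIT lte_mul_pinfty.
have H m : exists h : {nnsfun T >-> R}, (forall x, (h x <= u x)%R) /\
    V - (m.+1%:R^-1)%:E < \int[mu]_x (h x)%:E.
  have Sfin : ereal_sup S \is a fin_num by rewrite -VE.
  have m0 : (0 < m.+1%:R^-1 :> R)%R by rewrite invr_gt0.
  have [_ [h hu <-]] := ub_ereal_sup_adherent m0 Sfin.
  rewrite -VE => hV; exists h; split; last by rewrite integralT_nnsfun.
  by move=> x; rewrite -lee_fin.
have {H}[h hP] := choice H.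
have hu m x : (h m x <= u x)%R by have [] := hP m.
pose v x := sups (fun m => h m x) 0%N.
have ub x : has_ubound (range (fun m => h m x)).
  by exists (u x) => _ [m _ <-].
have hv m x : (h m x <= v x)%R.
  apply: ub_le_sup; last by exists m.
  by exists (u x) => _ [m' _ <-].
have vu x : (v x <= u x)%R.
  apply: ge_sup; first by exists (h 0%N x), 0%N.
  by move=> _ [m' _ <-].
have v0 x : (0 <= v x)%R by apply: le_trans (hv 0%N x).
have mv : measurable_fun setT v.
  apply: (@measurable_fun_sups _ _ _ setT (fun m => h m : T -> R)) => [x _|m].
    exact: ub.
  by [].
have mE (f : T -> R) : measurable_fun setT f -> measurable_fun setT (EFin \o f).
  by move=> mf; exact/measurable_EFinP.
have leV (g : T -> R) : (forall x, 0 <= g x)%R -> (forall x, g x <= u x)%R ->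
    \int[mu]_x (g x)%:E <= V.
  by move=> g0 gu; apply: le_integral_nonmeasurable => x; rewrite lee_fin.
have vV : \int[mu]_x (v x)%:E = V.
  apply/eqP; rewrite eq_le leV//=; apply/lee_addgt0Pr => eps eps0.
  have [m hm] : exists m, (m.+1%:R^-1 < eps)%R.
    by have [m _ /(_ m (leqnn m))] := near_infty_natSinv_lt (PosNum eps0); exists m.
  have [_ /ltW hV] := hP m.
  rewrite -leeBlDr//; apply: (@le_trans _ _ (V - (m.+1%:R^-1)%:E)).
    by rewrite leeB// lee_fin ltW.
  apply: (le_trans hV); apply: le_integral_nonmeasurable => x; rewrite lee_fin//.
exists v; split => // [x|nu numu]; first by rewrite v0 vu.
apply/eqP; rewrite eq_le; apply/andP; split; last first.
  by apply: le_integral_nonmeasurable => x; rewrite lee_fin.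
(* It suffices that a simple g below u is at most v almost everywhere for [nu]. The excess w of g
   over v satisfies v + w <= u while v already attains V, so w is null for [mu], hence for [nu]. *)
apply: integral_le_measurable_below => [x|g gu]; first by rewrite lee_fin.
have mg : measurable_fun setT g by [].
pose w x := Num.max (g x - v x)%R 0%R.
have mw : measurable_fun setT w.
  by apply: measurable_maxr => //; exact: measurable_funB.
have w0 x : (0 <= w x)%R by rewrite le_max lexx orbT.
have vwu x : (v x + w x <= u x)%R.
  have gux : (g x <= u x)%R by rewrite -lee_fin.
  by rewrite /w; have [_|_] := (leP (g x - v x) 0)%R; rewrite ?addr0 ?subrKC.
have w_int : \int[mu]_x (w x)%:E = 0.
  apply/eqP; rewrite eq_le integral_ge0 ?andbT; last by move=> x _; rewrite lee_fin.
  have : \int[mu]_x (v x + w x)%:E <= V by apply: leV => // x; rewrite addr_ge0.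
  under eq_integral do rewrite EFinD.
  rewrite ge0_integralD//; [|by move=> x _; rewrite lee_fin|exact: mE|
    by move=> x _; rewrite lee_fin|exact: mE].
  by rewrite vV -leeBrDl// subee.
have mN : measurable [set x | w x != 0%R].
  have := mw measurableT _ (measurableC (measurable_set1 (0%R : R))).
  rewrite setTI; congr measurable; apply/seteqP.
  by split=> x /= /eqP.
have muw : mu [set x | w x != 0%R] = 0.
  apply/(negligibleP _ mN).
  have /ae_eq_integral_abs : \int[mu]_x `|(w x)%:E| = 0.
    by under eq_integral do rewrite gee0_abs ?lee_fin//.
  move=> /(_ measurableT (mE _ mw)) [N [mN' N0 sN]]; exists N; split => //.
  by apply: subset_trans sN => x /= /eqP wx; apply: contra_not wx => /(_ Logic.I)[].
apply: ae_ge0_le_integral => //.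
- by move=> x _; rewrite lee_fin.
- exact: mE.
- by move=> x _; rewrite lee_fin.
- exact: mE.
have nuw : nu [set x | w x != 0%R] = 0.
  by apply/measure0_null_setP => //; apply: numu; exact/measure0_null_setP.
exists [set x | w x != 0%R]; split=> // x /= gv; apply/eqP => wx0; apply: gv => _.
rewrite lee_fin -subr_le0 -wx0 /w le_max lexx; exact: isT.
Qed.

(** The integral of g is the difference of the lower integrals of its positive part and of the
    positive part of -g. Each has an envelope with values in [0, B], and G is the difference of the
    two envelopes. *)
Lemma Rintegral_lower_envelope mu D (g : T -> R) (B : R) :
  measurable D -> mu D < +oo -> (0 <= B)%R -> (forall x, D x -> `|g x| <= B)%R ->
  exists G : T -> R, [/\ measurable_fun setT G, forall x, (`|G x| <= B)%R &
    forall nu, nu `<< mu -> nu D < +oo ->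
      (\int[nu]_(x in D) g x = \int[nu]_(x in D) G x)%R].
Proof.
move=> mD muD B0 gB.
(* The positive part is cut off to 0 outside D, as envelopes are integrated over the whole space. *)
pose part (f : T -> R) x := (Num.max (f x) 0 * \1_D x)%R.
have partP (f : T -> R) : (forall x, D x -> `|f x| <= B)%R ->
    forall x, (0 <= part f x <= B * \1_D x)%R.
  move=> fB x; rewrite /part indicE; have [/set_mem Dx|_] := boolP (x \in D).
    rewrite !mulr1 le_max lexx orbT ge_max B0 andbT /=.
    exact: le_trans (ler_norm _) (fB x Dx).
  by rewrite !mulr0 lexx.
have [p [mp p_le pE]] := measurable_lower_envelope mD muD (partP g gB).
have gB' x : D x -> (`|- g x| <= B)%R by rewrite normrN; exact: gB.
have [m [mm m_le mE]] := measurable_lower_envelope mD muD (partP (fun x => - g x)%R gB').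
have le_B (v f : T -> R) : (forall x, 0 <= v x <= part f x)%R ->
    (forall x, D x -> `|f x| <= B)%R -> forall x, (0 <= v x <= B)%R.
  move=> vf fB x; have /andP[-> vx] := vf x; rewrite (le_trans vx)//.
  have /andP[_ /le_trans] := partP f fB x; apply.
  by rewrite -[leRHS]mulr1 ler_wpM2l// indicE; case: (_ \in _).
have pB := le_B _ _ p_le gB; have mB := le_B _ _ m_le gB'.
exists (fun x => p x - m x)%R; split; first exact: measurable_funB.
  by move=> x; rewrite ler_norml; have := pB x; have := mB x; lra.
move=> nu numu nuD.
have integrable_part (v f : T -> R) : measurable_fun setT v ->
    (forall x, 0 <= v x <= B)%R -> nu.-integrable D (EFin \o v).
  move=> mv vB; apply: measurable_bounded_integrable => //.
    exact: measurable_funTS.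
  exists B; split; [exact: num_real|move=> c Bc x _ /=; rewrite ger0_norm].
    by have /andP[_ /le_trans] := vB x; apply; exact: ltW.
  by have /andP[] := vB x.
have ip := integrable_part p g mp pB; have im := integrable_part m g mm mB.
(* An envelope below [part f] vanishes outside D, so that integrals over the whole space become
   integrals over D. *)
have partE (v f : T -> R) : (forall x, 0 <= v x <= part f x)%R ->
    \int[nu]_x (part f x)%:E = \int[nu]_x (v x)%:E ->
    \int[nu]_(x in D) ((EFin \o f)^\+ x) = \int[nu]_(x in D) (v x)%:E.
  move=> vf fE; rewrite integral_mkcond [RHS]integral_mkcond.
  transitivity (\int[nu]_x (part f x)%:E).
    apply: eq_integral => x _; rewrite patchE /part indicE funeposE /=.
    by case: (x \in D); rewrite ?mulr1 ?mulr0// EFin_max.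
  rewrite fE; apply: eq_integral => x _; rewrite patchE.
  case: ifPn => // xD; have := vf x; rewrite /part indicE (negbTE xD) mulr0.
  by move=> v0; congr EFin; apply/eqP; rewrite eq_le andbC.
rewrite RintegralB// /Rintegral integralE.
rewrite (partE _ _ p_le (pE _ numu)).
have -> : \int[nu]_(x in D) ((EFin \o g)^\- x) = \int[nu]_(x in D) (m x)%:E.
  rewrite -(partE _ _ m_le (mE _ numu)); apply: eq_integral => x _.
  by rewrite funenegE funeposE.
by rewrite fineB//; exact: integrable_fin_num.
Qed.

(** The restriction to the whole space is a bundled finite measure, the form in which Radon-Nikodym
    derivatives are taken below. *)
Lemma finite_measureP nu : fin_num_fun nu ->
  exists nu' : {finite_measure set T -> \bar R},
    nu = nu' :> {measure set T -> \bar R}.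
Proof.
move=> fin_nu.
have nuT : nu setT < +oo by rewrite ltey_eq fin_nu.
exists (mfrestr measurableT nuT); apply: eq_measure; apply/funext => A.
by rewrite /= /mfrestr /mrestr /= setIT.
Qed.

(** The density q and the Radon-Nikodym derivative have the same integral over every measurable
    subset of D, so they agree almost everywhere there, and the change of variables carries over to
    q. The domination holds because q integrates to 0 over null sets. *)
Lemma Rintegral_density (mu : {sigma_finite_measure set T -> \bar R})
    nu D (q f : T -> R) :
  fin_num_fun nu -> measurable D -> measurable_fun D q ->
  (forall A, measurable A -> nu A = \int[mu]_(x in A `&` D) (q x)%:E) ->
  nu.-integrable D (EFin \o f) ->
  (nu `<< mu) /\
  (\int[nu]_(x in D) f x = \int[mu]_(x in D) (f x * q x))%R.
Proof.
move=> /finite_measureP[{}nu ->] mD mq nuE fi.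
have mqA A : A `<=` D -> measurable_fun A (EFin \o q).
  by move=> AD; apply/measurable_EFinP; exact: measurable_funS mq.
have numu : nu `<< mu.
  move=> N N0 A mA AN; rewrite nuE//; apply: null_set_integral.
  - exact: measurableI.
  - by apply: mqA => x [].
  - by apply: N0; [exact: measurableI|apply: subset_trans AN => x []].
split=> //; rewrite /Rintegral -(Radon_Nikodym_change_of_variables numu mD fi).
congr fine; apply: ae_eq_integral => //.
- apply: emeasurable_funM; first exact: measurable_int fi.
  apply: measurable_funTS; apply: (measurable_int mu).
  exact: Radon_Nikodym_integrable.
- under eq_fun do rewrite EFinM.
  by apply: emeasurable_funM; [exact: measurable_int fi|exact: mqA].
- under [X in ae_eq _ _ _ X]eq_fun do rewrite EFinM.
  apply: ae_eqe_mul2l; apply: integral_ae_eq => //.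
  + by apply: (integrableS measurableT) => //; exact: Radon_Nikodym_integrable.
  + exact: mqA.
  + move=> E ED mE; rewrite -Radon_Nikodym_integral// [LHS]nuE//.
    by rewrite (setIidl ED).
Qed.

End integral_nonmeasurable.

(** * The cube under Lebesgue measure *)

Section lebesgue_cube.
Context {R : realType}.

Lemma measurable_cube n : measurable (cube n : set 'rV[R]_n).
Proof.
have -> : cube n = \bigcap_(i in [set: 'I_n])
    ((fun x : 'rV[R]_n => x 0 i) @^-1` `[-1, 1]).
  apply/seteqP; split=> x cx i; first by move=> _; rewrite /= in_itv/=; exact: cx.
  by have := cx i Logic.I; rewrite /= in_itv.
apply: fin_bigcap_measurable; first exact: finite_finset.
move=> i _; rewrite -[X in measurable X]setTI.
exact: (@measurable_entry _ R 1 n 0 i measurableT _ (measurable_itv `[-1, 1])).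
Qed.

(** [row_cons] pulls the cube back to the product of [-1, 1] and the cube of one dimension less; in
    dimension 0 the measure is a Dirac mass. *)
Lemma lebesgue_row_cube n :
  (lebesgue_row n (cube n : set 'rV[R]_n) < +oo)%E.
Proof.
elim: n => [|n IH].
  by rewrite /= diracE; case: (_ \in _); rewrite ltry.
have cubeE : @row_cons R n @^-1` cube n.+1 = `[-1, 1]%classic `*` cube n
    :> set (measurableTypeR R * 'rV[R]_n).
  have r0 (x : R) (v : 'rV[R]_n) : row_cons (x, v) 0 0 = x.
    by rewrite -[LHS]/(row_uncons (row_cons (x, v))).1 row_consK.
  have rS (x : R) (v : 'rV[R]_n) i : row_cons (x, v) 0 (lift ord0 i) = v 0 i.
    have -> : lift ord0 i = rshift 1 i by apply/val_inj.
    by rewrite (@row_mxEr _ 1 1 n).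
  apply/seteqP; split=> -[x v] /=.
    move=> cxv; split=> [|i].
      by have := cxv 0; rewrite r0 in_itv.
    by have := cxv (lift ord0 i); rewrite rS.
  move=> [xI cv] i; have [j ->|->] := unliftP ord0 i; first by rewrite rS; exact: cv.
  by move: xI; rewrite r0 in_itv.
have -> : lebesgue_row n.+1 (cube n.+1) =
   (@lebesgue_measure R \x lebesgue_row n)%E (`[-1, 1]%classic `*` cube n).
  by rewrite -cubeE.
rewrite product_measure1E//; last exact: measurable_cube.
rewrite lte_mul_pinfty ?measure_ge0//.
have := lebesgue_measure_itv (R := R) `[-1, 1]; rewrite /= lte_fin gtrN// => lE.
by rewrite [X in X \is a fin_num]lE.
Qed.

End lebesgue_cube.

(** * Measurability of derivatives in a parameter *)

Section measurable_partials.
Context {R : realType} {n : nat} d (S : measurableType d).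

(** Along [inward_step], which does not depend on the parameter s, a partial derivative is the limit
    of a sequence of difference quotients, each measurable in s by induction. *)
Lemma measurable_partials k (D : set S) (p : S -> 'rV[R]_n -> R) (w : seq 'I_n) :
  (forall s, D s -> continuously_differentiable k (p s)) ->
  (forall z, cube n z -> measurable_fun D (fun s => p s z)) ->
  (size w <= k)%N ->
  forall z, cube n z -> measurable_fun D (fun s => partials w (p s) z).
Proof.
move=> cdp mp; elim: w => [_ z|i w IH wk z cz]; first exact: mp.
apply: (@measurable_fun_cvg _ _ _ D
  (fun m s => diff_quotient (partials w (p s)) i z (inward_step i z m))).
  move=> m; rewrite /diff_quotient; apply: measurable_funM => //.
  apply: measurable_funB; apply: (IH (ltnW wk)) => //.
  exact: cube_inward_step.
move=> s Ds; have dw := @derivable_partials _ _ k (p s) w i (cdp s Ds) wk.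
exact: cvg_comp (cvg_inward_step cz) (partial_cvg cz dw).
Qed.

End measurable_partials.

(** * Sums and parameter integrals of Taylor families *)

Section taylor_family_ops.
Context {R : realType} {n : nat}.

Lemma taylor_familyD k (K1 K2 : R) (phi1 phi2 : seq 'I_n -> 'rV[R]_n -> R) :
  taylor_family k K1 phi1 -> taylor_family k K2 phi2 ->
  taylor_family k (K1 + K2) (fun w x => phi1 w x + phi2 w x).
Proof.
move=> h1 h2 w wk; have [b1 l1 t1] := h1 w wk; have [b2 l2 t2] := h2 w wk.
split=> [x cx|x y cx cy|wk' i x t cx ct].
- by rewrite (le_trans (ler_normD _ _))// lerD ?b1 ?b2.
- by rewrite opprD addrACA (le_trans (ler_normD _ _))// mulrDl lerD ?l1 ?l2.
- set a1 := phi1 w _; set a2 := phi2 w _; set c1 := phi1 w _; set c2 := phi2 w _.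
  rewrite (_ : _ - _ = (a1 - c1 - t * phi1 (i :: w) x) +
    (a2 - c2 - t * phi2 (i :: w) x)); last by ring.
  by rewrite (le_trans (ler_normD _ _))// mulrDl lerD ?t1 ?t2.
Qed.

Section integral.
Context d (S : measurableType d) (mu : {measure set S -> \bar R}).
Variables (D : set S) (G : S -> R) (B : R).
Hypotheses (mD : measurable D) (muD : (mu D < +oo)%E).
Hypotheses (mG : measurable_fun D G) (GB : forall s, `|G s| <= B).

Let integrableG (psi : S -> R) (c : R) : measurable_fun D psi ->
  (forall s, D s -> `|psi s| <= c) ->
  mu.-integrable D (EFin \o (fun s => G s * psi s)).
Proof.
move=> mpsi psic; apply: measurable_bounded_integrable => //.
  exact: measurable_funM.
exists (B * c); split; first exact: num_real.
move=> M BM s Ds /=; rewrite (le_trans _ (ltW BM))// normrM ler_pM//.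
exact: psic.
Qed.

Let le_integralG (psi : S -> R) (c : R) : measurable_fun D psi ->
  (forall s, D s -> `|psi s| <= c) ->
  `|\int[mu]_(s in D) (G s * psi s)| <= B * c * fine (mu D).
Proof.
move=> mpsi psic; have ig := integrableG mpsi psic.
rewrite (le_trans (le_normr_Rintegral mD ig))// -(Rintegral_cst mu mD).
apply: le_Rintegral => //.
- exact: integrable_norm.
- apply: measurable_bounded_integrable => //.
  exists `|B * c|; split; first exact: num_real.
  by move=> M /ltW BM s Ds.
- by move=> s Ds; rewrite normrM ler_pM ?psic.
Qed.

(** The three conditions bound expressions that are linear in [phi s]. Integration against G
    commutes with them and multiplies their bounds by at most B times the measure of D. *)
Lemma taylor_family_integral k (K : R) (phi : S -> seq 'I_n -> 'rV[R]_n -> R) :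
  (forall s, D s -> taylor_family k K (phi s)) ->
  (forall w x, (size w <= k)%N -> cube n x ->
    measurable_fun D (fun s => phi s w x)) ->
  taylor_family k (B * K * fine (mu D))
    (fun w x => \int[mu]_(s in D) (G s * phi s w x)).
Proof.
move=> hphi mphi w wk.
have intG w' x : (size w' <= k)%N -> cube n x ->
    mu.-integrable D (EFin \o (fun s => G s * phi s w' x)).
  move=> wk' cx; apply: (@integrableG _ K); first exact: mphi.
  by move=> s Ds; have [b _ _] := hphi s Ds w' wk'; exact: b.
split=> [x cx|x y cx cy|wk' i x t cx ct].
- apply: le_integralG; first exact: mphi.
  by move=> s Ds; have [b _ _] := hphi s Ds w wk; exact: b.
- rewrite -RintegralB//; try exact: intG.
  under eq_Rintegral do rewrite -mulrBr.
  rewrite mulrAC -(mulrA B).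
  apply: le_integralG; first by apply: measurable_funB; exact: mphi.
  by move=> s Ds; have [_ l _] := hphi s Ds w wk; exact: l.
- rewrite -RintegralB//; try exact: intG.
  rewrite -RintegralZl//; last exact: intG.
  rewrite -RintegralB//; last 2 first.
  + have := integrableB mD (intG w _ wk ct) (intG w _ wk cx).
    by apply: eq_integrable => // s _ /=; rewrite EFinB.
  + have := integrableZl mD t (intG (i :: w) _ wk' cx).
    by apply: eq_integrable => // s _ /=; rewrite EFinM.
  (* The integrand is again G times the Taylor remainder of [phi s]. *)
  under eq_Rintegral do rewrite mulrCA -!mulrBr.
  rewrite mulrAC -(mulrA B).
  apply: le_integralG.
    apply: measurable_funB; first by apply: measurable_funB; exact: mphi.
    by apply: measurable_funM => //; exact: mphi.
  by move=> s Ds; have [_ _ l] := hphi s Ds w wk; exact: l.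
Qed.

End integral.
End taylor_family_ops.

(** * Regularity of the Bellman operator *)

Section bellman_regularity.
Context {R : realType} {dS dA H : nat} (M : mdp R dS dA H).

Lemma nu_star_nat (nu : nat) : (0 < nu)%N -> nu_star (nu%:R : R) = nu.-1.
Proof.
move=> nu0; rewrite /nu_star -[in LHS](prednK nu0) -natr1 addrK.
by rewrite pmulrn intrKceil.
Qed.

Lemma sup_norm_fin (f : 'rV[R]_(dS + dA) -> R) : Linfty f ->
  exists B : R, [/\ sup_norm f = B%:E, 0 <= B &
    forall x, cube (dS + dA) x -> `|f x| <= B].
Proof.
move=> [_ foo].
have fB x : cube (dS + dA) x -> (`|f x|%:E <= sup_norm f)%E.
  by move=> cx; apply: ereal_sup_ubound; exists x.
have f0 : (0 <= sup_norm f)%E by apply: le_trans (fB 0 cube0); rewrite lee_fin.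
have BE : sup_norm f = (fine (sup_norm f))%:E by rewrite fineK// ge0_fin_numE.
exists (fine (sup_norm f)); split=> // [|x cx]; first exact: fine_ge0.
by rewrite -lee_fin -BE; exact: fB.
Qed.

Lemma cube_row_mx (s : 'rV[R]_dS) (a : 'rV[R]_dA) :
  cube dS s -> cube dA a -> cube (dS + dA) (row_mx s a).
Proof.
move=> cs ca i; case: (split_ordP i) => j ->.
  by rewrite row_mxEl; exact: cs.
by rewrite row_mxEr; exact: ca.
Qed.

Lemma sup_actions_le (f : 'rV[R]_(dS + dA) -> R) (B : R) :
  (forall x, cube (dS + dA) x -> `|f x| <= B) -> forall s, cube dS s ->
  `|sup [set f (row_mx s a) | a in cube dA]| <= B.
Proof.
move=> fB s cs; set A := [set _ | _ in _].
have AB y : A y -> - B <= y <= B.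
  by move=> [a ca <-]; rewrite -ler_norml; apply/fB/cube_row_mx.
(* The zero action makes the set nonempty; being bounded as well, it has a genuine supremum and not
   a default value. *)
have A0 : A (f (row_mx s 0)) by exists 0 => //; exact: cube0.
rewrite ler_norml; apply/andP; split.
  have /andP[Bf _] := AB _ A0; apply: (le_trans Bf); apply: ub_le_sup => //.
  by exists B => y /AB /andP[].
by apply: ge_sup; [exists (f (row_mx s 0))|move=> y /AB /andP[]].
Qed.

Lemma bellman_taylor_family k (h : 'I_H) (p : 'rV[R]_dS -> 'rV[R]_(dS + dA) -> R)
    (f : 'rV[R]_(dS + dA) -> R) (Kr Kp B : R) :
  (forall z, cube (dS + dA) z -> is_density (transition M h z) (p ^~ z)) ->
  taylor_family k Kr (partials^~ (reward M h)) ->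
  (forall s, cube dS s -> continuously_differentiable k (p s)) ->
  (forall s, cube dS s -> taylor_family k Kp (partials^~ (p s))) ->
  0 <= B -> (forall x, cube (dS + dA) x -> `|f x| <= B) ->
  exists2 phi, taylor_family k (Kr + B * Kp * fine (lebesgue_row dS (cube dS))) phi &
    {in cube (dS + dA), bellman M h f =1 phi [::]}.
Proof.
move=> dens hr cdp hp B0 fB.
(* G is obtained before z is introduced: one envelope serves all the kernel measures
   [transition M h z], each dominated by Lebesgue measure. *)
have [G [mG GB GE]] := Rintegral_lower_envelope (@measurable_cube R dS)
  (lebesgue_row_cube dS) B0 (sup_actions_le fB).
have mp w x : (size w <= k)%N -> cube (dS + dA) x ->
    measurable_fun (cube dS) (fun s => partials w (p s) x).
  move=> wk cx; apply: (measurable_partials (k := k)) => // z cz.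
  by have [] := dens z cz.
have hI := taylor_family_integral (@measurable_cube R dS) (lebesgue_row_cube dS)
  (measurable_funTS mG) GB hp mp.
exists (fun w z => partials w (reward M h) z +
  \int[lebesgue_row dS]_(s in cube dS) (G s * partials w (p s) z)).
  exact: taylor_familyD hr hI.
move=> z; rewrite inE => cz; rewrite /bellman; congr (_ + _).
have [mq _ qE] := dens z cz.
have fin_nu : fin_num_fun (transition M h z) by exact: finite_kernel_measure.
have nuoo : (transition M h z (cube dS) < +oo)%E by rewrite transition_cube// ltry.
have iG : (transition M h z).-integrable (cube dS) (EFin \o G).
  apply: measurable_bounded_integrable => //; first exact: measurable_cube.
    exact: measurable_funTS.
  by exists B; split; [exact: num_real|move=> c /ltW Bc x _; exact: le_trans Bc].
have [dom densE] := Rintegral_density fin_nu (@measurable_cube R dS) mq qE iG.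
(* [GE] first replaces the supremum over actions by G under the kernel measure; the density then
   leads to Lebesgue measure. *)
by rewrite (GE _ dom nuoo) densE.
Qed.

End bellman_regularity.

Theorem mainTheorem4 (R : realType) (dS dA H nu : nat) (M : mdp R dS dA H) :
  (0 < dS)%N -> (0 < dA)%N -> (1 <= nu)%N ->
  strongly_smooth nu.-1 M -> mildly_smooth nu%:R M.
Proof.
move=> _ _ nu0 [p [dens [Cr [Cp rp_smooth]]]].
(* The constant of [holder_taylor_family] in dimension dS + dA. *)
pose K (C : R) := (dS + dA).+1%:R * (`|C| + 1).
pose vol : R := fine (lebesgue_row dS (cube dS)).
have K0 C : 0 <= K C by rewrite mulr_ge0// addr_ge0.
have vol0 : 0 <= vol by rewrite fine_ge0.
(* The Taylor constant of the Bellman image is K Cr + B (K Cp) vol with B = [sup_norm f], at most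
   this witness times B + 1. *)
exists (K Cr + K Cp * vol) => h f Lf.
have [B [BE B0 fB]] := sup_norm_fin Lf.
have [[hr norm_r] hp] := rp_smooth h.
have cdp s : cube dS s -> continuously_differentiable nu.-1 (p h s).
  by move=> cs; have [[]] := hp s cs.
have tp s : cube dS s -> taylor_family nu.-1 (K Cp) (partials^~ (p h s)).
  by move=> cs; have [hps norm_p] := hp s cs; exact: holder_taylor_family.
have tr : taylor_family nu.-1 (K Cr) (partials^~ (reward M h)).
  exact: holder_taylor_family.
have [phi tphi fphi] := bellman_taylor_family (dens h) tr cdp tp B0 fB.
have [hol normf] := taylor_family_holder tphi fphi.
(* For integer nu, the Holder exponent nu - [nu_star] equals 1. *)
rewrite /C_space /C_norm nu_star_nat// -[X in X%:R - _](prednK nu0) -natr1.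
rewrite (addrC _ 1) addrK; split=> //; apply: (le_trans normf).
rewrite BE -EFinD -EFinM lee_fin -/vol.
have := mulr_ge0 (K0 Cr) B0; have := mulr_ge0 (K0 Cp) vol0.
by move: (K Cr) (K Cp) => Kr Kp; nra.
Qed.
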